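(* Let $\Omega\subset\mathbb{R}^n$ be a proper, open, nonempty subset, let $1<p<\infty$, $p'=p/(p-1)$, and $0<\beta<1$. Let $(u,v)$ be a pair of weights such that $\sigma=v^{1-p'}$ is a weight. Assume that the operator $M_{\beta,\sigma}$ is bounded from $L^p(\sigma)$ to $L^p(\sigma)$. Then $M_\beta$ is bounded from $L^p(v)$ to $L^p(u)$ if and only if there is a constant $C$ such that $$\int_F \big(M_\beta(\sigma\chi_F)\big)^p\,u\,dx\ \le\ C\int_F\sigma\,dx<\infty$$ for every finite union $F=\bigcup_{i}Q_i$ of cubes $Q_i\in\mathcal{F}_\beta$.
   Context: Cubes have sides parallel to the axes; $Q(x,l)$ is the cube with center $x$ and half side length $l>0$. $\mathrm{d}$ is the $d_\infty$ metric on $\mathbb{R}^n$, and $\mathrm{d}(x,\Omega^c)$ the corresponding distance to $\Omega^c=\mathbb{R}^n\setminus\Omega$. $\mathcal{F}_\beta=\{Q(x,l): x\in\Omega,\ l<\beta\,\mathrm{d}(x,\Omega^c)\}$. A weight is a nonnegative locally integrable function on $\Omega$. For $x\in\Omega$ and a locally integrable $f$ on $\Omega$, the local maximal function is $M_\beta f(x)=\sup_{x\in Q\in\mathcal{F}_\beta}\frac1{|Q|}\int_Q|f(y)|\,dy$, and for a weight $\sigma$, $M_{\beta,\sigma}f(x)=\sup_{x\in Q\in\mathcal{F}_\beta}\frac1{\sigma(Q)}\int_Q|f(y)|\,\sigma(y)\,dy$, where $\sigma(Q)=\int_Q\sigma\,dx$. For a weight $w$, $L^p(w)$ is the space of measurable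 $f$ on $\Omega$ with $\int_\Omega|f|^p w\,dx<\infty$. An operator $T$ is bounded from $L^p(v)$ to $L^q(u)$ if there is a constant $C$ with $\left(\int_\Omega |Tf|^q u\,dx\right)^{1/q}\le C\left(\int_\Omega|f|^p v\,dx\right)^{1/p}$ for all $f\in L^p(v)$. *)

(* Defs.v *)
From HB Require Import structures.
From mathcomp Require Import all_boot all_order all_algebra.
From mathcomp Require Import all_classical all_reals all_analysis.
From mathcomp Require Import measurable_realfun.

Set Implicit Arguments.
Unset Strict Implicit.
Unset Printing Implicit Defensive.

Import Order.TTheory GRing.Theory Num.Theory.
Import numFieldNormedType.Exports.

Local Open Scope classical_set_scope.
Local Open Scope ring_scope.
Local Open Scope ereal_scope.

(* R^d, d >= 1, is 'rV[R]_n.+1 with d = n.+1.  The library puts the sup norm  *)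
(* on it, so that ball x l is the open cube with center x and half side l.    *)

Section lebesgue.
Context (R : realType) (n : nat).
Implicit Types (a b x : 'rV[R]_n.+1) (A : set 'rV[R]_n.+1).

Definition box a b : set 'rV[R]_n.+1 :=
  [set x | forall i, (a ord0 i < x ord0 i < b ord0 i)%R].

Definition box_vol a b : R :=
  (\prod_(i < n.+1) Num.max 0 (b ord0 i - a ord0 i))%R.

Definition box_cover A : set (nat -> 'rV[R]_n.+1 * 'rV[R]_n.+1) :=
  [set c | A `<=` \bigcup_k box (c k).1 (c k).2].

Definition lebesgue_outer A : \bar R :=
  ereal_inf [set \sum_(k <oo) (box_vol (c k).1 (c k).2)%:E | c in box_cover A].

Let vol_ge0 (c : 'rV[R]_n.+1 * 'rV[R]_n.+1) : 0 <= (box_vol c.1 c.2)%:E.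
Proof. by rewrite lee_fin prodr_ge0// => i _; rewrite le_max lexx. Qed.

Lemma le_lebesgue_outer : {homo lebesgue_outer : A B / A `<=` B >-> A <= B}.
Proof.
move=> A B AB; apply/ereal_inf_le_tmp => x [c Bc <-{x}].
by exists c => //; exact: subset_trans AB Bc.
Qed.

Lemma lebesgue_outer_ge0 A : 0 <= lebesgue_outer A.
Proof.
by apply: le_ereal_inf_tmp => x [c _ <-{x}]; apply: nneseries_ge0 => k _ _.
Qed.

Lemma lebesgue_outer0 : lebesgue_outer set0 = 0.
Proof.
apply/eqP; rewrite eq_le lebesgue_outer_ge0 andbT.
apply: ereal_inf_lbound; exists (fun=> (0%R, 0%R)); first by move=> ?.
apply: eseries0 => k _ _ /=.
by rewrite /box_vol big_ord_recl subrr maxxx mul0r.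
Qed.

Lemma lebesgue_outer_sigma_subadditive : sigma_subadditive lebesgue_outer.
Proof.
move=> A; have [[i ioo]|] := pselect (exists i, lebesgue_outer (A i) = +oo).
  rewrite (eseries_pinfty _ _ ioo) ?leey// => k _.
  by rewrite -ltNye (lt_le_trans _ (lebesgue_outer_ge0 _)).
rewrite -forallNE => Aoo.
suff add2e (e : {posnum R}) : lebesgue_outer (\bigcup_k A k) <=
    \sum_(i <oo) lebesgue_outer (A i) + e%:num%:E.
  by apply/lee_addgt0Pr => _/posnumP[].
rewrite (le_trans _ (epsilon_trick _ _ _))//; last first.
  by move=> k; exact: lebesgue_outer_ge0.
pose vol (c : 'rV[R]_n.+1 * 'rV[R]_n.+1) := (box_vol c.1 c.2)%:E.
pose P k c := box_cover (A k) c /\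
  \sum_(j <oo) vol (c j) <= lebesgue_outer (A k) + (e%:num / (2 ^ k.+1)%:R)%:E.
have [G PG] : {G : nat -> nat -> 'rV[R]_n.+1 * 'rV[R]_n.+1 & forall k, P k (G k)}.
  apply: (@choice _ _ P) => k; rewrite /P /lebesgue_outer.
  set S := (X in ereal_inf X); move infS : (ereal_inf S) => iS.
  case: iS infS => [r Sr|Soo|Soo].
  - have en1 : (0 < e%:num / (2 ^ k.+1)%:R)%R by [].
    have /(lb_ereal_inf_adherent en1) : ereal_inf S \is a fin_num by rewrite Sr.
    move=> [x [c Ac cx] xS].
    by exists c; split => //; rewrite [leLHS]cx -Sr; exact/ltW.
  - by have := Aoo k; rewrite /lebesgue_outer Soo.
  - suff : lbound S 0 by move/le_ereal_inf_tmp; rewrite Soo.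
    by move=> /= _ [c _ <-]; apply: nneseries_ge0 => ? _ _.
have G_ge0 (x : nat * nat) : 0 <= (vol \o uncurry G) x by apply: vol_ge0.
apply: (@le_trans _ _ (\esum_(i in setT) (vol \o uncurry G) i)).
  apply: ereal_inf_lbound => /=.
  have /card_esym/ppcard_eqP[f] := card_nat2.
  exists (uncurry G \o f).
    move=> t [i _ Ait]; have [j _ Gt] := (PG i).1 t Ait.
    by exists (f^-1%FUN (i, j)) => //=; rewrite invK ?inE.
  rewrite -(esum_pred_image (vol \o uncurry G) _ xpredT) ?[fun=> _]set_true//.
  by rewrite image_eq.
rewrite (_ : esum _ _ = \sum_(i <oo) \sum_(j <oo ) vol (G i j)); last first.
  pose J : nat -> set (nat * nat) := fun i => [set (i, j) | j in setT].
  rewrite (_ : setT = \bigcup_k J k); last first.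
    by rewrite predeqE => -[a b]; split => // _; exists a => //; exists b.
  rewrite esum_bigcupT /=; last 2 first.
    - apply/trivIsetP => i j _ _ ij.
      rewrite predeqE => -[k m] /=; split => //= -[] [_] _ [<-{k} _].
      by move=> [m' _] [] /esym/eqP; rewrite (negbTE ij).
    - by move=> /= [k m]; exact: (G_ge0 (k, m)).
  rewrite -(image_id [set: nat]) -fun_true esum_pred_image//; last first.
    by move=> k _; apply: esum_ge0 => x _; exact: (G_ge0 x).
  apply: eq_eseriesr => /= j _.
  rewrite -(esum_pred_image (vol \o uncurry G) (pair j) predT)//=; last 2 first.
    - by move=> i _; exact: (G_ge0 (j, i)).
    - by move=> ? ? _ _; exact: (@can_inj _ _ _ snd).
  by congr esum; rewrite predeqE => -[a b]; split; move=> [i _ <-]; exists i.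
apply: lee_lim.
- apply: is_cvg_nneseries => k *.
  by apply: nneseries_ge0 => m *; exact: (G_ge0 (k, m)).
- apply: is_cvg_nneseries => k *; apply: adde_ge0 => //.
  exact: lebesgue_outer_ge0.
- by near=> k; apply: lee_sum => i _; exact: (PG i).2.
Unshelve. all: by end_near. Qed.

HB.instance Definition _ := isOuterMeasure.Build R 'rV[R]_n.+1 lebesgue_outer
  lebesgue_outer0 lebesgue_outer_ge0 le_lebesgue_outer
  lebesgue_outer_sigma_subadditive.

End lebesgue.

(* R^d with its Lebesgue measurable sets; convertible to 'rV[R]_n.+1.         *)
Notation Leb R n := (caratheodory_type (@lebesgue_outer R n)).

(* Lebesgue measure on R^d (complete, as every Caratheodory measure).         *)
Definition lebesgue_rV (R : realType) (n : nat) : set (Leb R n) -> \bar R :=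
  @lebesgue_outer R n.
HB.instance Definition _ (R : realType) (n : nat) :=
  isMeasure.Build _ (Leb R n) R (@lebesgue_rV R n)
    (@caratheodory_measure0 R _ (@lebesgue_outer R n))
    (@caratheodory_measure_ge0 R _ (@lebesgue_outer R n))
    (@caratheodory_measure_sigma_additive R _ (@lebesgue_outer R n)).

Section local_maximal.
Context (R : realType) (n : nat) (Omega : set 'rV[R]_n.+1).
Local Notation Rd := 'rV[R]_n.+1.
Local Notation mu := (@lebesgue_rV R n).
Implicit Types (f w : Rd -> \bar R) (p q beta : R).

Definition measurable_on (D : set Rd) f : Prop :=
  measurable_fun (D : set (Leb R n)) (f : Leb R n -> \bar R).

(* Functions on Omega are total functions to \bar R of which only the values  *)
(* on Omega are used.  Extended values let v^(1-p') be +oo where v = 0; local *)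
(* integrability makes a weight finite almost everywhere.                     *)
Definition weight w : Prop :=
  [/\ measurable_on Omega w,
      (forall x, Omega x -> 0 <= w x) &
      (forall K, compact K -> K `<=` Omega -> \int[mu]_(x in K) w x < +oo)].

Definition dist_setC (x : Rd) : R := inf [set `|x - y|%R | y in ~` Omega].

Definition cubes beta : set (set Rd) :=
  [set Q | exists x l, [/\ Omega x, (0 < l)%R, (l < beta * dist_setC x)%R &
                           Q = ball x l]].

Definition maxfun beta f (x : Rd) : \bar R :=
  ereal_sup [set (mu Q)^-1 * \int[mu]_(y in Q) `|f y| |
             Q in [set Q | cubes beta Q /\ Q x]].

Definition wmaxfun beta w f (x : Rd) : \bar R :=
  ereal_sup [set (\int[mu]_(y in Q) w y)^-1 * \int[mu]_(y in Q) (`|f y| * w y) |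
             Q in [set Q | cubes beta Q /\ Q x]].

Definition in_Lp p w f : Prop :=
  measurable_on Omega f /\ \int[mu]_(x in Omega) (`|f x| `^ p * w x) < +oo.

Definition bounded_op (T : (Rd -> \bar R) -> Rd -> \bar R) p v q u : Prop :=
  exists C : R, forall f, in_Lp p v f ->
    (\int[mu]_(x in Omega) (`|T f x| `^ q * u x)) `^ q^-1 <=
      C%:E * (\int[mu]_(x in Omega) (`|f x| `^ p * v x)) `^ p^-1.

Definition conj_exp p : R := (p / (p - 1))%R.

(* v^(1-p') on [0, +oo], with 1 - p' < 0; not v `^ (1 - p'), because the      *)
(* library sets 0 `^ r = 0 and +oo `^ r = +oo also for r < 0.                 *)
Definition dual_weight p w (x : Rd) : \bar R := (w x `^ (conj_exp p - 1))^-1.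

Lemma dual_weightE p w (x : Rd) (r : R) : (0 < r)%R -> w x = r%:E ->
  dual_weight p w x = (r `^ (1 - conj_exp p))%:E.
Proof.
move=> r0 wx; rewrite /dual_weight wx poweR_EFin inver gt_eqF ?powR_gt0//.
by rewrite -powRN opprB.
Qed.

End local_maximal.

(* Main.v *)
(* Write f = g sigma.  For finitely many cubes Q_1, ..., Q_N sorted so that the
   sigma-averages a_1 >= ... >= a_N of g decrease, put F_m = Q_1 u ... u Q_m and
   d_m = a_m^p - a_(m+1)^p >= 0 (with a_(N+1) = 0).  The average of f over Q_i
   is a_i times sigma(Q_i) / |Q_i|, and the latter ratio is at most
   M(sigma 1_(F_m)) on Q_i for every m >= i.  As a_i^p is the sum of the d_m
   over m >= i, the p-th power of the maximal function over these N cubes is at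
   most the sum of d_m M(sigma 1_(F_m))^p over the m with x in F_m.  Integrating
   against u, the testing condition bounds this by C times the sum of
   d_m sigma(F_m), which is the integral of (max a_i 1_(Q_i))^p sigma, hence at
   most that of (M_sigma g)^p sigma.  A countable family of cubes already
   realizes M f, and monotone convergence concludes.  For the converse, apply
   the bound to f = sigma 1_F. *)
Require Import Defs.
From HB Require Import structures.
From mathcomp Require Import all_boot all_order all_algebra.
From mathcomp Require Import all_classical all_reals all_analysis.
From mathcomp Require Import measurable_realfun lra.

Set Implicit Arguments.
Unset Strict Implicit.
Unset Printing Implicit Defensive.

Import Order.TTheory GRing.Theory Num.Theory.
Import numFieldNormedType.Exports.

Local Open Scope classical_set_scope.
Local Open Scope ring_scope.

(** * Lebesgue measurability of half-spaces, boxes, cubes and open sets *)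

Section lebesgue_measurable_sets.
Context (R : realType) (n : nat).
Local Notation Rd := 'rV[R]_n.+1.
Local Open Scope ereal_scope.

Definition upd_row (i : 'I_n.+1) (r : R) (x : Rd) : Rd :=
  \row_j (if j == i then r else x ord0 j).

Lemma box_vol_updl i r (a b : Rd) : box_vol (upd_row i r a) b =
  (Num.max 0 (b ord0 i - r) *
   \prod_(j < n.+1 | j != i) Num.max 0 (b ord0 j - a ord0 j))%R.
Proof.
rewrite /box_vol (bigD1 i)//= mxE eqxx; congr (_ * _)%R.
by apply: eq_bigr => j /negPf ji; rewrite mxE ji.
Qed.

Lemma box_vol_updr i r (a b : Rd) : box_vol a (upd_row i r b) =
  (Num.max 0 (r - a ord0 i) *
   \prod_(j < n.+1 | j != i) Num.max 0 (b ord0 j - a ord0 j))%R.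
Proof.
rewrite /box_vol (bigD1 i)//= mxE eqxx; congr (_ * _)%R.
by apply: eq_bigr => j /negPf ji; rewrite mxE ji.
Qed.

Lemma box_vol_ge0 (a b : Rd) : (0 <= box_vol a b)%R.
Proof. by apply: prodr_ge0 => i _; rewrite le_max lexx. Qed.

Lemma box_vol_split i (r e : R) (a b : Rd) : (0 < e)%R ->
  {d : R | (0 < d)%R &
    (box_vol a (upd_row i (Num.min r (b ord0 i)) b) +
     box_vol (upd_row i (Num.max (r - d) (a ord0 i)) a) b
       <= box_vol a b + e)%R}.
Proof.
move=> e0; set P := (\prod_(j < n.+1 | j != i)
  Num.max 0 (b ord0 j - a ord0 j))%R.
have P0 : (0 <= P)%R by apply: prodr_ge0 => j _; rewrite le_max lexx.
have P1 : (0 < P + 1)%R by rewrite ltr_wpDl.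
(* The summand 1 keeps the denominator positive when [P] is 0. *)
have d0 : (0 < e / (P + 1))%R by rewrite divr_gt0.
exists (e / (P + 1))%R => //; set d := (e / (P + 1))%R in d0 *.
rewrite box_vol_updl box_vol_updr -/P.
have -> : box_vol a b = (Num.max 0 (b ord0 i - a ord0 i) * P)%R.
  by rewrite /box_vol (bigD1 i).
have dP : (d * P <= e)%R.
  by rewrite /d mulrAC ler_pdivrMr// ler_pM2l// lerDl.
rewrite -mulrDl; apply: (@le_trans _ _
  ((Num.max 0 (b ord0 i - a ord0 i) + d) * P)%R);
  last by rewrite mulrDl lerD2l.
apply: ler_wpM2r => //.
rewrite /Num.max /Num.min.
by repeat case: ifPn => //; rewrite -?leNgt; lra.
Qed.

(** Cutting every box of a cover of [X] covers both parts of [X]; the k-th cut is allowed the error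
    e / 2^(k+1), and these errors add up to e. *)
Lemma caratheodory_halfspace (i : 'I_n.+1) (r : R) :
  caratheodory_measurable (@lebesgue_outer R n) [set x | (x ord0 i < r)%R].
Proof.
apply: le_caratheodory_measurable => X.
apply: le_ereal_inf_tmp => _ [c Xc <-].
apply/lee_addgt0Pr => e e0.
have ek k : (0 < e / (2 ^ k.+1)%:R)%R by rewrite divr_gt0// ltr0n expn_gt0.
pose d k := s2val (box_vol_split i r (c k).1 (c k).2 (ek k)).
pose d0 k : (0 < d k)%R := s2valP (box_vol_split i r (c k).1 (c k).2 (ek k)).
pose dP k := s2valP' (box_vol_split i r (c k).1 (c k).2 (ek k)).
pose c1 k := ((c k).1, upd_row i (Num.min r ((c k).2 ord0 i))%R (c k).2).
pose c2 k :=
  (upd_row i (Num.max (r - d k) ((c k).1 ord0 i))%R (c k).1, (c k).2).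
have v0 (c' : Rd * Rd) : 0 <= (box_vol c'.1 c'.2)%:E.
  by rewrite lee_fin box_vol_ge0.
apply: (@le_trans _ _ (\sum_(k <oo) (box_vol (c1 k).1 (c1 k).2)%:E +
                       \sum_(k <oo) (box_vol (c2 k).1 (c2 k).2)%:E)).
  apply: leeD; apply: ereal_inf_lbound.
  - exists c1 => // x [Xx /= xr]; have [k _ xk] := Xc x Xx.
    exists k => // j; have /andP[-> xb] := xk j.
    rewrite mxE /=; case: eqP => [->|//].
    by rewrite lt_min xr; case/andP: (xk i).
  - exists c2 => // x [Xx /= /negP]; rewrite -leNgt => xr.
    have [k _ xk] := Xc x Xx; exists k => // j; have /andP[xa ->] := xk j.
    rewrite mxE /= andbT; case: eqP => [->|//].
    (* The overlap [d k] gives the strict inequality also at points with x_i = r. *)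
    rewrite gt_max; move: (xk i) => /andP[-> _]; rewrite andbT.
    by rewrite (lt_le_trans _ xr)// ltrBlDr ltrDl d0.
rewrite -nneseriesD => [|k _ _|k _ _]; [|exact: v0|exact: v0].
apply: le_trans (epsilon_trick xpredT _ _) => [||]; last exact: ltW.
  apply: lee_nneseries => k _; first by rewrite adde_ge0// v0.
  by rewrite -!EFinD lee_fin /c1 /c2 /=; exact: dP.
by move=> k; exact: v0.
Qed.

Lemma measurable_halfspace_lt (i : 'I_n.+1) (r : R) :
  measurable ([set x | (x ord0 i < r)%R] : set (Leb R n)).
Proof. exact: caratheodory_halfspace. Qed.

Lemma measurable_halfspace_gt (i : 'I_n.+1) (r : R) :
  measurable ([set x | (r < x ord0 i)%R] : set (Leb R n)).
Proof.
rewrite -[X in measurable X]setCK; apply: measurableC.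
rewrite (_ : ~` _ = \bigcap_(k : nat)
    ([set x : Rd | (x ord0 i < r + k.+1%:R^-1)%R])).
  by apply: bigcapT_measurable => k; exact: measurable_halfspace_lt.
apply/seteqP; split => x /=.
  move=> /negP; rewrite -leNgt => xr k _ /=.
  by rewrite (le_lt_trans xr)// ltrDl.
move=> xr; apply/negP; rewrite -leNgt; apply/ler_addgt0Pr => e e0.
have [k ke] : exists k : nat, (k.+1%:R^-1 < e)%R.
  have [k _ /(_ k (leqnn k)) ke] := near_infty_natSinv_lt (PosNum e0).
  by exists k.
by apply: le_trans (ltW (xr k I)) _; rewrite lerD2l ltW.
Qed.

Lemma measurable_box (a b : Rd) : measurable (box a b : set (Leb R n)).
Proof.
rewrite (_ : box a b = \bigcap_(i in [set: 'I_n.+1])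
  ([set x : Rd | (a ord0 i < x ord0 i)%R] `&`
   [set x : Rd | (x ord0 i < b ord0 i)%R])).
  apply: (@fin_bigcap_measurable _ (Leb R n)) => // i _; apply: measurableI.
    exact: measurable_halfspace_gt.
  exact: measurable_halfspace_lt.
apply/seteqP; split => x /= xab i; first by move=> _; apply/andP; exact: xab.
by apply/andP; exact: xab.
Qed.

Lemma ball_box (x : Rd) (l : R) : (0 < l)%R ->
  ball x l = box (x - const_mx l) (x + const_mx l).
Proof.
move=> l0; apply/seteqP; split => y.
  move=> [_ xy] i; have := xy ord0 i.
  rewrite /ball/= !mxE ltr_distlC => /andP[? ?]; apply/andP; split; lra.
move=> xy; split=> // i j; have := xy j.
rewrite (ord1 i) /ball/= !mxE ltr_distlC => /andP[? ?]; apply/andP; split; lra.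
Qed.

Lemma measurable_cube (x : Rd) (l : R) : measurable (ball x l : set (Leb R n)).
Proof.
have [l0|l0] := ltP 0%R l; first by rewrite ball_box//; exact: measurable_box.
(* Membership in a ball of row vectors includes 0 < l, so the ball is empty for l <= 0. *)
rewrite (_ : ball x l = set0)//; apply/seteqP; split => // y [l1].
by rewrite ltNge l0 in l1.
Qed.

Definition rat_ball (q : 'rV[rat]_n.+1 * rat) : set Rd :=
  ball (map_mx ratr q.1 : Rd) (ratr q.2).

(** The radius is a rational below e / 2 and the center a rational point closer to x than this
    radius, so the ball contains x and stays within e of it. *)
Lemma open_rat_ball (U : set Rd) (x : Rd) : open U -> U x ->
  exists q, rat_ball q x /\ rat_ball q `<=` U.
Proof.
rewrite openE => /(_ x) /[apply] /nbhs_ballP[e /= e0 eU].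
have e20 : (0 < e / 2)%R by rewrite divr_gt0.
have [r] := rat_in_itvoo e20; rewrite in_itv/= => /andP[r0 re].
have xr i : (x ord0 i - ratr r < x ord0 i + ratr r)%R.
  by rewrite ltrBlDr -addrA ltrDl addr_gt0.
pose q : 'rV[rat]_n.+1 := \row_i sval (cid (rat_in_itvoo (xr i))).
have qP i : (`|x ord0 i - ratr (q ord0 i)| < ratr r)%R.
  rewrite mxE ltr_distlC; case: cid => s /=; rewrite in_itv/=.
  by case/andP=> ? ?; apply/andP; split; lra.
exists (q, r); split.
  split=> // i j; rewrite (ord1 i) mxE; apply: ball_sym; exact: qP.
move=> y [_ yq]; apply: eU; split => // i j.
have := yq i j; rewrite !(ord1 i) mxE => yj.
have xj := qP j; rewrite /ball/= in yj *.
rewrite (_ : _ - _ = (x ord0 j - ratr (q ord0 j)) +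
  (ratr (q ord0 j) - y ord0 j))%R; last by rewrite addrA subrK.
by apply: le_lt_trans (ler_normD _ _) _; lra.
Qed.

Lemma measurable_open (U : set Rd) : open U -> measurable (U : set (Leb R n)).
Proof.
move=> oU.
(* Rational balls not inside [U] are replaced by the empty set, so that the union runs over a whole
   countable type. *)
rewrite (_ : U = \bigcup_(q : 'rV[rat]_n.+1 * rat)
   (if `[<rat_ball q `<=` U>] then rat_ball q else set0)).
  apply: (@countable_bigcupT_measurable _ (Leb R n)) => [|q].
    exact: countableP.
  by case: ifP => _; [exact: measurable_cube|exact: measurable0].
apply/seteqP; split => [x /(open_rat_ball oU)[q [qx qU]]|x [q _]].
  by exists q => //; rewrite asboolT.
by case: asboolP => // qU /qU.
Qed.

Lemma measurable_closed (A : set Rd) :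
  closed A -> measurable (A : set (Leb R n)).
Proof.
by move=> cA; rewrite -[A]setCK; apply/measurableC/measurable_open/closed_openC.
Qed.

End lebesgue_measurable_sets.

(** * Lower bound for the total volume of a cover by boxes *)

Section box_cover_volume.
Context (R : realType).
Local Open Scope ereal_scope.

(* The hypothesis is integrated against the one-dimensional Lebesgue measure in
   one coordinate at a time, which makes compactness unnecessary. *)
Lemma box_cover_volume (d : nat) (l h : nat -> R) (c : nat -> R)
    (a b : nat -> nat -> R) :
  (forall j, l j <= h j)%R -> (forall k, 0 <= c k)%R ->
  (forall x : nat -> R, (forall j, (j < d)%N -> l j < x j < h j)%R ->
    1 <= \sum_(k <oo)
      (c k * \prod_(j < d) (x j \in `]a k j, b k j[)%:R)%:E) ->
  (\prod_(j < d) (h j - l j))%:E <=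
    \sum_(k <oo) (c k * \prod_(j < d) Num.max 0 (b k j - a k j))%:E.
Proof.
move=> lh; elim: d c => [|d IH] c c0 H.
  rewrite big_ord0; apply: le_trans (H (fun=> 0%R) _) _ => //.
  rewrite le_eqVlt; apply/orP; left; apply/eqP/eq_eseriesr => k _.
  by rewrite !big_ord0.
pose P k := (\prod_(j < d) Num.max 0 (b k j - a k j))%R.
have P0 k : (0 <= P k)%R by apply: prodr_ge0 => j _; rewrite le_max lexx.
(* Fixing the last coordinate at [t] multiplies each coefficient by the indicator of its last
   interval; this is why general coefficients [c] are carried through the induction. *)
have slice t : (l d < t < h d)%R ->
    (\prod_(j < d) (h j - l j))%:E <=
    \sum_(k <oo) ((c k * P k)%:E * (\1_(`]a k d, b k d[%classic) t)%:E).
  move=> lth.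
  have -> : \sum_(k <oo) ((c k * P k)%:E * (\1_(`]a k d, b k d[%classic) t)%:E)
    = \sum_(k <oo) ((c k * (t \in `]a k d, b k d[)%:R) * P k)%:E.
    by apply: eq_eseriesr => k _; rewrite -EFinM indicE mem_setE mulrAC.
  apply: IH => [k|x xlh]; first by rewrite mulr_ge0.
  have := H (fun j => if j == d then t else x j).
  have E k : (c k * \prod_(j < d.+1)
      ((if j == d :> nat then t else x j) \in `]a k j, b k j[)%:R)%R =
      (c k * (t \in `]a k d, b k d[)%:R *
        \prod_(j < d) (x j \in `]a k j, b k j[)%:R)%R.
    rewrite big_ord_recr /= eqxx -mulrA; congr (_ * _)%R; rewrite mulrC.
    congr (_ * _)%R; apply: eq_bigr => j _.
    by rewrite ltn_eqF.
  under eq_eseriesr do rewrite E.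
  apply => j; rewrite ltnS leq_eqVlt; case: eqP => [->//|_ /= jd].
  exact: xlh.
have mI (u v : R) : measurable (`]u, v[%classic : set R).
  exact: measurable_itv.
have term0 k t : 0 <= (c k * P k)%:E * (\1_(`]a k d, b k d[%classic) t)%:E.
  by rewrite -EFinM lee_fin !mulr_ge0.
have mterm k : measurable_fun `]l d, h d[%classic
    (fun t => (c k * P k)%:E * (\1_(`]a k d, b k d[%classic) t)%:E).
  apply: emeasurable_funM => //.
  by apply/measurable_EFinP/measurable_indic; exact: mI.
rewrite big_ord_recr/= EFinM.
pose mu := @lebesgue_measure R.
apply: (@le_trans _ _ (\int[mu]_(t in `]l d, h d[)
    (\prod_(j < d) (h j - l j))%:E)).
  rewrite integral_cst//= lebesgue_measure_itv/= lte_fin.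
  have := lh d; rewrite le_eqVlt => /predU1P[->|->]; last by rewrite EFinB.
  by rewrite subrr ltxx.
apply: (@le_trans _ _ (\int[mu]_(t in `]l d, h d[) \sum_(k <oo)
    ((c k * P k)%:E * (\1_(`]a k d, b k d[%classic) t)%:E))).
  apply: ge0_le_integral => //.
  - move=> t _; rewrite lee_fin; apply: prodr_ge0 => j _; rewrite subr_ge0//.
  - apply: ge0_emeasurable_sum => k; first by move=> x _ _; apply: term0.
    by move=> _; exact: mterm.
(* Sum and integral are exchanged; the k-th indicator then integrates to at most the length of its
   interval. *)
rewrite integral_nneseries//=.
apply: lee_nneseries => [k _ _|k _].
  by apply: integral_ge0 => x _; exact: term0.
rewrite ge0_integralZl//; last 2 first.
- by apply/measurable_EFinP/measurable_indic; exact: mI.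
- by rewrite lee_fin mulr_ge0.
rewrite integral_indic//= big_ord_recr/= mulrA [leRHS]EFinM -/(P k).
apply: lee_wpmul2l; first by rewrite lee_fin mulr_ge0.
apply: (@le_trans _ _ (mu `]a k d, b k d[%classic)).
  apply: le_measure; rewrite ?inE//; first exact: measurableI.
rewrite [leLHS]lebesgue_measure_itv/= lte_fin; case: ifPn => ab.
  by rewrite -EFinB lee_fin le_max lexx orbT.
by rewrite lee_fin le_max lexx.
Qed.

End box_cover_volume.

(** * Positivity of the measure of cubes *)

Section cube_measure.
Context (R : realType) (n : nat).
Local Notation Rd := 'rV[R]_n.+1.
Local Notation mu := (@lebesgue_rV R n).
Local Open Scope ereal_scope.

(** At each point of the box the indicators of the covering boxes sum to at least 1, so
    [box_cover_volume] with unit coefficients applies to every cover. *)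
Lemma lebesgue_box_ge (l h : Rd) : (forall i, l ord0 i <= h ord0 i)%R ->
  (\prod_(i < n.+1) (h ord0 i - l ord0 i))%:E <= mu (box l h).
Proof.
move=> lh; apply: le_ereal_inf_tmp => _ [c cP <-].
(* [inord] sends indices above n to 0, so the order of [l] and [h] holds at every natural index. *)
pose coord (x : Rd) j := x ord0 (inord j : 'I_n.+1).
have coordE x (i : 'I_n.+1) : coord x i = x ord0 i by rewrite /coord inord_val.
have := @box_cover_volume R n.+1 (coord l) (coord h) (fun=> 1%R)
  (fun k => coord (c k).1) (fun k => coord (c k).2).
under eq_bigr do rewrite !coordE.
have -> : \sum_(k <oo) (1 * \prod_(j < n.+1)
    Num.max 0 (coord (c k).2 j - coord (c k).1 j))%:E =
    \sum_(k <oo) (box_vol (c k).1 (c k).2)%:E.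
  apply: eq_eseriesr => k _; rewrite mul1r /box_vol; congr EFin.
  by apply: eq_bigr => i _; rewrite !coordE.
apply => // [j|x xlh]; first exact: lh.
have [k _ xk] : (\bigcup_k box (c k).1 (c k).2) (\row_i x i).
  by apply: cP => i; rewrite mxE -!coordE; exact: xlh.
rewrite (@nneseriesD1 _ _ k)//; last first.
  by move=> i _; rewrite lee_fin mul1r prodr_ge0.
rewrite big1 ?mulr1; last first.
  by move=> j _; have := xk j; rewrite mxE in_itv/= !coordE => ->.
rewrite leeDl//; apply: nneseries_ge0 => i _ _.
by rewrite lee_fin mul1r prodr_ge0.
Qed.

Lemma cube_measure_gt0 (x : Rd) (r : R) : (0 < r)%R -> 0 < mu (ball x r).
Proof.
move=> r0; rewrite ball_box//; apply: lt_le_trans (lebesgue_box_ge _).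
  by rewrite lte_fin; apply: prodr_gt0 => i _; rewrite !mxE; lra.
by move=> i; rewrite !mxE; lra.
Qed.

End cube_measure.

(** * Cubes inside [Omega], and suprema over them reduced to countably many *)

Lemma ereal_rat_dense (R : realType) (x y : \bar R) :
  (x < y)%E -> exists q : rat, (x < (ratr q)%:E < y)%E.
Proof.
have dense (a b : R) : a < b -> exists q : rat, (a%:E < (ratr q)%:E < b%:E)%E.
  move=> ab; have [q] := rat_in_itvoo ab.
  by rewrite in_itv/= => abq; exists q; rewrite !lte_fin.
have inter (a b : R) : a < b -> (x <= a%:E)%E -> (b%:E <= y)%E ->
    exists q : rat, (x < (ratr q)%:E < y)%E.
  move=> /dense[q /andP[aq qb]] xa by_; exists q.
  by rewrite (le_lt_trans xa aq) (lt_le_trans qb by_).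
case: x y inter => [a||] [b||]//= inter ab.
- by apply: (inter a b).
- by apply: (inter a (a + 1)); rewrite ?ltrDl ?leey.
- by apply: (inter (b - 1) b); rewrite ?ltrBlDr ?ltrDl ?leNye.
- by apply: (inter 0 1); rewrite ?ltr01 ?leNye ?leey.
Qed.

Section cubes.
Context (R : realType) (n : nat) (Omega : set 'rV[R]_n.+1) (beta : R).
Local Notation Rd := 'rV[R]_n.+1.
Local Notation mu := (@lebesgue_rV R n).
Local Notation cubes := (cubes Omega beta).
Hypotheses (oO : open Omega) (OT : Omega <> setT).
Hypotheses (b0 : 0 < beta) (b1 : beta < 1).

Lemma dist_setC_le (x y : Rd) : ~ Omega y -> dist_setC Omega x <= `|x - y|.
Proof. by move=> Oy; apply: ge_inf; [exists 0 => _ [z _ <-]|exists y]. Qed.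

(** A ball of radius e inside [Omega] bounds all distances below by e; the complement has to be
    nonempty because [inf] of the empty set is 0. *)
Lemma dist_setC_gt0 (x : Rd) : Omega x -> 0 < dist_setC Omega x.
Proof.
move: oO; rewrite openE => /(_ x) /[apply] /nbhs_ballP[e /= e0 eO].
have [y Oy] : ~` Omega !=set0.
  by apply/set0P/eqP => OC; apply: OT; rewrite -(setCK Omega) OC setC0.
apply: lt_le_trans e0 _; apply: lb_le_inf; first by exists `|x - y|; exists y.
move=> _ [z Oz <-]; rewrite leNgt; apply/negP => zx; apply: Oz; apply: eO.
by rewrite -ball_normE.
Qed.

Lemma dist_setC_ge0 (x : Rd) : 0 <= dist_setC Omega x.
Proof.
have [y Oy] : ~` Omega !=set0.
  by apply/set0P/eqP => OC; apply: OT; rewrite -(setCK Omega) OC setC0.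
by apply: lb_le_inf; [exists `|x - y|; exists y|move=> _ [z _ <-]].
Qed.

(** The closed cube serves as [K]: with d the distance from x to the complement, l < beta d <= d, so
    it stays in [Omega]. Local integrability thereby applies to cubes. *)
Lemma cube_subset_compact (Q : set Rd) : cubes Q ->
  exists K, [/\ compact K, Q `<=` K & K `<=` Omega].
Proof.
move=> [x [l [Ox l0 lb ->]]]; exists (closed_ball x l); split.
- apply: bounded_closed_compact; last exact: closed_ball_closed.
  rewrite closed_ballE//; exists (`|x| + l); split; first exact: num_real.
  move=> M xM y xy /=; apply: ltW; apply: le_lt_trans xM.
  rewrite -[y](subrK x) addrC; apply: le_trans (ler_normD _ _) _.
  by rewrite lerD2l distrC.
- by move=> y xy; apply: subset_closed_ball.
- move=> y; rewrite closed_ballE// => xy; apply: contrapT => Oy.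
  have := dist_setC_le x Oy; apply/negP; rewrite -ltNge.
  apply: le_lt_trans (_ : l < _); first exact: xy.
  by apply: lt_le_trans lb _; rewrite ler_piMl// ?dist_setC_ge0// ltW.
Qed.

Lemma cube_subset (Q : set Rd) : cubes Q -> Q `<=` Omega.
Proof. by move=> /cube_subset_compact[K [_ QK KO]]; apply: subset_trans KO. Qed.

Lemma cube_open (Q : set Rd) : cubes Q -> open Q.
Proof. by move=> [x [l [_ l0 _ ->]]]; apply: ball_open. Qed.

Lemma cube_measurable (Q : set Rd) : cubes Q -> measurable (Q : set (Leb R n)).
Proof. by move=> /cube_open; apply: measurable_open. Qed.

Lemma cubes_cover (x : Rd) : Omega x -> exists2 Q, cubes Q & Q x.
Proof.
move=> Ox; have d0 := dist_setC_gt0 Ox.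
have bd0 : 0 < beta * dist_setC Omega x by rewrite mulr_gt0.
exists (ball x (beta * dist_setC Omega x / 2)).
  exists x, (beta * dist_setC Omega x / 2).
  split=> //; first by rewrite divr_gt0.
  by rewrite ltr_pdivrMr// ltr_pMr// ltr1n.
by apply: ballxx; rewrite divr_gt0.
Qed.

Lemma cubes_measure_gt0 (Q : set Rd) : cubes Q -> (0 < mu Q)%E.
Proof. by move=> [x [l [_ l0 _ ->]]]; exact: cube_measure_gt0. Qed.

Lemma finite_cubes_subset_compact (D : set (set Rd)) :
  finite_set D -> D `<=` cubes ->
  exists K, [/\ compact K, \bigcup_(Q in D) Q `<=` K & K `<=` Omega].
Proof.
move=> fD Dc.
have /choice[K KP] Q : exists K, D Q ->
    [/\ compact K, Q `<=` K & K `<=` Omega].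
  have [DQ|] := pselect (D Q); last by exists set0.
  by have [K ?] := cube_subset_compact (Dc _ DQ); exists K.
exists (\bigcup_(Q in D) K Q); split.
- rewrite -bigsetU_fset_set// big_seq; apply: bigsetU_compact => Q.
  by rewrite in_fset_set// inE => DQ; have [] := KP _ DQ.
- by move=> x [Q DQ Qx]; exists Q => //; have [_ QK _] := KP _ DQ; exact: QK.
- by move=> x [Q DQ KQx]; have [_ _] := KP _ DQ; apply.
Qed.

Lemma finite_cubes_open (D : set (set Rd)) : D `<=` cubes ->
  open (\bigcup_(Q in D) Q).
Proof. by move=> Dc; apply: bigcup_open => Q /Dc /cube_open. Qed.

(** Both [maxfun] and [wmaxfun] are instances, with [phi] the respective average. *)
Definition sup_cubes (phi : set Rd -> \bar R) (x : Rd) : \bar R :=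
  ereal_sup [set phi Q | Q in [set Q | cubes Q /\ Q x]].

Lemma le_sup_cubes (phi : set Rd -> \bar R) (Q : set Rd) (x : Rd) :
  cubes Q -> Q x -> (phi Q <= sup_cubes phi x)%E.
Proof. by move=> cQ Qx; apply: ereal_sup_ubound; exists Q. Qed.

Lemma sup_cubes_ge0 (phi : set Rd -> \bar R) (x : Rd) :
  (forall Q, 0 <= phi Q)%E -> Omega x -> (0 <= sup_cubes phi x)%E.
Proof.
move=> phi0 /cubes_cover[Q cQ Qx].
by apply: le_trans (le_sup_cubes _ cQ Qx).
Qed.

(** A superlevel set is a union of open cubes, hence open, whatever [phi] is. *)
Lemma measurable_sup_cubes (phi : set Rd -> \bar R) :
  measurable_on Omega (sup_cubes phi).
Proof.
apply: (measurability _ (ErealGenOInfty.measurableE R)).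
move=> /= _ [_ [a ->]] <-; apply: measurable_open; apply: openI => //.
rewrite preimage_itvoy.
rewrite (_ : [set x | _] =
    \bigcup_(Q in [set Q | cubes Q /\ (a%:E < phi Q)%E]) Q).
  by apply: bigcup_open => Q [/cube_open].
apply/seteqP; split => x /=.
  by move=> /ereal_sup_gtP[_ [Q [cQ Qx] <-] aQ]; exists Q.
by move=> [Q [cQ aQ] Qx]; apply: lt_le_trans aQ (le_sup_cubes _ cQ Qx).
Qed.

(** For each rational ball and rational threshold, one cube containing the ball with [phi] above the
    threshold is chosen if there is any. A cube Q around x with [phi Q] above the countable supremum
    is refuted by a threshold in between and a rational ball with x inside Q. *)
Lemma sup_cubes_countable (phi : set Rd -> \bar R) : Omega !=set0 ->
  exists2 q : nat -> set Rd, (forall k, cubes (q k)) &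
    forall x, (sup_cubes phi x <=
      ereal_sup [set phi (q k) | k in [set k | q k x]])%E.
Proof.
move=> [x0 Ox0]; have [Q0 cQ0 _] := cubes_cover Ox0.
pose T := ('rV[rat]_n.+1 * rat * rat)%type.
have /choice[G GP] (i : T) : exists G, cubes G /\
   ((exists Q,
      [/\ cubes Q, @rat_ball R n i.1 `<=` Q & (ratr i.2)%:E < phi Q]%E) ->
    @rat_ball R n i.1 `<=` G /\ ((ratr i.2)%:E < phi G)%E).
  have [[Q [? ? ?]]|H] := pselect (exists Q,
    [/\ cubes Q, @rat_ball R n i.1 `<=` Q & (ratr i.2)%:E < phi Q]%E).
    by exists Q.
  by exists Q0.
(* Numbers that encode no index are sent to the spare cube [Q0]. *)
exists (fun k => if unpickle k is Some i then G i else Q0).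
  by move=> k; case: unpickle => // i; case: (GP i).
move=> x; apply/ereal_supP => _ [Q [cQ Qx] <-]; rewrite leNgt; apply/negP.
move=> /ereal_rat_dense[r /andP[Sr rQ]].
have [b [bx bQ]] := open_rat_ball (cube_open cQ) Qx.
have [_ []] := GP (b, r); first by exists Q.
move=> bG rG; move: Sr; apply/negP; rewrite -leNgt; apply: le_trans (ltW rG) _.
apply: ereal_sup_ubound; exists (pickle ((b, r) : T)); rewrite /= pickleK//.
exact: bG.
Qed.

End cubes.

(** * Powers and roots of nonnegative extended reals *)

Section poweR_bounds.
Context (R : realType).
Local Open Scope ereal_scope.
Implicit Types (x y u S : \bar R) (p r C : R).

Lemma le_poweR r x y : (0 <= r)%R -> 0 <= x -> x <= y -> x `^ r <= y `^ r.
Proof.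
move=> r0 x0 xy; apply: gt0_ler_poweR => //; rewrite in_itv/= leey andbT//.
exact: le_trans xy.
Qed.

Lemma poweRK r x : (r != 0)%R -> 0 <= x -> (x `^ r) `^ r^-1 = x.
Proof. by move=> r0 x0; rewrite -poweRrM mulfV// poweRe1. Qed.

Lemma poweRVK r x : (r != 0)%R -> 0 <= x -> (x `^ r^-1) `^ r = x.
Proof. by move=> r0 x0; rewrite -poweRrM mulVf// poweRe1. Qed.

Lemma poweR_le_root r x y :
  (0 < r)%R -> 0 <= x -> x `^ r <= y -> x <= y `^ r^-1.
Proof.
move=> r0 x0 xy; rewrite -[leLHS](@poweRK r)// ?gt_eqF//.
by apply: le_poweR => //; [rewrite invr_ge0 ltW|exact: poweR_ge0].
Qed.

(** Turns a norm inequality as in [bounded_op] into one between integrals. The constant there has no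
    prescribed sign, hence the absolute value. *)
Lemma le_of_le_root p C x y : (0 < p)%R -> 0 <= x -> 0 <= y ->
  x `^ p^-1 <= C%:E * y `^ p^-1 -> x <= (`|C| `^ p)%:E * y.
Proof.
move=> p0 x0 y0 xy; rewrite -[leLHS](@poweRVK p) ?gt_eqF//.
rewrite -[y in leRHS](@poweRVK p) ?gt_eqF// -poweR_EFin -poweRM ?poweR_ge0//.
apply: le_poweR; [exact: ltW|exact: poweR_ge0|].
by apply: le_trans xy _; rewrite lee_wpmul2r ?poweR_ge0// lee_fin ler_norm.
Qed.

Lemma root_le_of_le p C x y : (0 < p)%R -> 0 <= x -> 0 <= y ->
  x <= C%:E * y -> x `^ p^-1 <= (`|C| `^ p^-1)%:E * y `^ p^-1.
Proof.
move=> p0 x0 y0 xy; rewrite -poweR_EFin -poweRM//.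
apply: le_poweR => //; first by rewrite invr_ge0 ltW.
by apply: le_trans xy _; rewrite lee_wpmul2r// lee_fin ler_norm.
Qed.

(** For 0 < u < +oo the bound is solved for a. For u = +oo either the supremum is 0, or some a > 0
    forces S = +oo. *)
Lemma ereal_sup_poweR_mul_le (A : set (\bar R)) p u S : (0 < p)%R -> 0 <= u ->
  0 <= S -> 0 <= ereal_sup A -> (forall a, A a -> 0 <= a) ->
  (forall a, A a -> a `^ p * u <= S) -> ereal_sup A `^ p * u <= S.
Proof.
move=> p0 u0 S0 A0 Apos H; case: u u0 H => [u| |//].
- rewrite lee_fin le_eqVlt => /predU1P[<-|u0] H; first by rewrite mule0.
  rewrite -lee_pdivlMr//.
  have supA : ereal_sup A <= (S * u^-1%:E) `^ p^-1.
    apply/ereal_supP => a Aa; apply: poweR_le_root => //; first exact: Apos.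
    by rewrite lee_pdivlMr//; exact: H.
  rewrite -[leRHS](@poweRVK p) ?gt_eqF//.
    by apply: le_poweR => //; exact: ltW.
  by rewrite mule_ge0// lee_fin invr_ge0 ltW.
- move=> _ H; move: A0; rewrite le_eqVlt => /predU1P[<-|].
    by rewrite poweR0r ?gt_eqF// mul0e.
  move=> /ereal_sup_gtP[a Aa a0]; have := H _ Aa.
  by rewrite gt0_muley ?poweR_gt0// leye_eq => /eqP ->; rewrite leey.
Qed.

End poweR_bounds.

(** * Pointwise relations between [v] and [sigma] *)

Section dual_weight.
Context (R : realType) (n : nat) (p : R) (v : 'rV[R]_n.+1 -> \bar R).
Hypothesis p1 : (1 < p)%R.
Local Notation q := (conj_exp p - 1)%R.
Local Notation sigma := (dual_weight p v).
Local Open Scope ereal_scope.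

Lemma conj_expB1 : q = (p - 1)^-1%R.
Proof.
have p10 : (p - 1 != 0)%R by rewrite subr_eq0 gt_eqF.
rewrite /conj_exp -[X in (_ - X)%R](divff p10) -mulrBl.
by rewrite opprB addrCA subrr addr0 mul1r.
Qed.

Lemma conj_expB1_gt0 : (0 < q)%R.
Proof. by rewrite conj_expB1 invr_gt0 subr_gt0. Qed.

(** This is (p' - 1) p = p', by which the powers of [v] cancel in the two pointwise bounds below. *)
Lemma conj_expB1M : (q * p = 1 + q)%R.
Proof.
have p10 : (p - 1 != 0)%R by rewrite subr_eq0 gt_eqF.
rewrite conj_expB1 -[X in (_ * X)%R](subrK 1%R) mulrDr mulVf// mulr1//.
Qed.

Lemma dual_weight_ge0 x : 0 <= v x -> 0 <= sigma x.
Proof. by move=> v0; rewrite /dual_weight inve_ge0 poweR_ge0. Qed.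

(** Equality holds for v > 0. At v = 0 the left side is +oo * 0 = 0 while sigma = +oo. *)
Lemma dual_weight_poweR_le x : 0 <= v x -> sigma x `^ p * v x <= sigma x.
Proof.
have q0 := conj_expB1_gt0; have p0 : (0 < p)%R by rewrite (lt_trans _ p1).
move=> v0; have := dual_weight_ge0 v0; rewrite /dual_weight.
case: (v x) v0 => [r| |//].
- rewrite lee_fin le_eqVlt => /predU1P[<-|r0] s0; first by rewrite mule0.
  rewrite !poweR_EFin inver gt_eqF ?powR_gt0//.
  rewrite poweR_EFin -EFinM lee_fin -powR_inv1 ?powR_ge0// -!powRrM.
  rewrite -[X in (_ * X)%R](powRr1 (ltW r0)) -powRD; last first.
    by rewrite (gt_eqF r0) implybT.
  by rewrite !mulN1r !mulrN mulr1 conj_expB1M opprD addrAC addNr add0r.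
- by move=> _ _; rewrite poweRyr ?gt_eqF// invey poweR0r ?gt_eqF// mul0e.
Qed.

(* f v^(p'-1) is f / sigma; unlike the quotient it vanishes where v = 0, that is
   where sigma = +oo, so that the bound holds everywhere. *)
Lemma quotient_poweR_le (f : \bar R) x : 0 <= v x -> 0 <= f ->
  (f * v x `^ q) `^ p * sigma x <= f `^ p * v x.
Proof.
have q0 := conj_expB1_gt0; have p0 : (0 < p)%R by rewrite (lt_trans _ p1).
move=> v0 f0; rewrite /dual_weight; case: (v x) v0 => [r| |//].
- rewrite lee_fin le_eqVlt => /predU1P[<-|r0].
    by rewrite [0 `^ q]poweR0r ?gt_eqF// mule0 poweR0r ?gt_eqF// mul0e mule0.
  rewrite poweRM// ?poweR_ge0// -muleA lee_wpmul2l ?poweR_ge0//.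
  rewrite !poweR_EFin inver gt_eqF ?powR_gt0// -EFinM lee_fin.
  rewrite -powRrM conj_expB1M (@powRD _ _ 1%R q); last first.
    by rewrite (gt_eqF r0) implybT.
  rewrite (powRr1 (ltW r0)) mulfK ?lexx// gt_eqF//.
  by rewrite powR_gt0.
- by move=> _; rewrite poweRyr ?gt_eqF// invey mule0 mule_ge0 ?poweR_ge0.
Qed.

Lemma quotientK (f : \bar R) x : 0 <= v x -> v x \is a fin_num ->
  sigma x \is a fin_num -> f * v x `^ q * sigma x = f.
Proof.
have q0 := conj_expB1_gt0.
rewrite /dual_weight; case: (v x) => [r| |]// r0 _.
(* At v = 0 the value of [sigma] is +oo, against its finiteness. *)
have [->|rn0] := eqVneq r 0%R; first by rewrite poweR0r ?gt_eqF// inve0.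
move=> _; have {}r0 : (0 < r)%R by rewrite lt_neqAle eq_sym rn0.
rewrite poweR_EFin inver gt_eqF ?powR_gt0// -muleA -EFinM divff ?mule1//.
by rewrite gt_eqF// powR_gt0.
Qed.

Lemma dual_weight_gt0 x : 0 <= v x -> v x \is a fin_num -> 0 < sigma x.
Proof.
rewrite /dual_weight; case: (v x) => [r| |]// r0 _.
rewrite poweR_EFin inver; case: ifPn => // h.
by rewrite lte_fin invr_gt0 lt_neqAle eq_sym h powR_ge0.
Qed.

End dual_weight.

(** * Integrals of weights over cubes *)

Section weights.
Context (R : realType) (n : nat) (Omega : set 'rV[R]_n.+1) (beta : R).
Local Notation Rd := 'rV[R]_n.+1.
Local Notation mu := (@lebesgue_rV R n).
Local Notation leb := (mu : {measure set (Leb R n) -> \bar R}).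
Local Notation cubes := (cubes Omega beta).
Hypotheses (oO : open Omega) (OT : Omega <> setT) (b1 : beta < 1).
Local Open Scope ereal_scope.

Let cubeO (Q : set Rd) (cQ : cubes Q) := @cube_subset R n Omega beta OT b1 Q cQ.
Let cubeM (Q : set Rd) (cQ : cubes Q) := @cube_measurable R n Omega beta Q cQ.

Lemma measurable_on_subset (D : set Rd) (f : Rd -> \bar R) :
  D `<=` Omega -> measurable_on Omega f -> measurable_on D f.
Proof. by move=> DO; apply: measurable_funS => //; exact: measurable_open. Qed.

Lemma measurable_on_poweR (p : R) (f w : Rd -> \bar R) :
  measurable_on Omega f -> measurable_on Omega w ->
  measurable_on Omega (fun x => f x `^ p * w x).
Proof.
move=> mf mw; apply: emeasurable_funM; last exact: mw.
exact: (measurableT_comp (measurable_poweR p) mf).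
Qed.

Lemma weight_finite_cubes_lty (w : Rd -> \bar R) (D : set (set Rd)) :
  weight Omega w -> finite_set D -> D `<=` cubes ->
  \int[mu]_(x in \bigcup_(Q in D) Q) w x < +oo.
Proof.
move=> [mw w0 wK] fD Dc.
have [K [cK DK KO]] := finite_cubes_subset_compact OT b1 fD Dc.
apply: le_lt_trans (wK K cK KO); apply: ge0_subset_integral => //.
- exact/measurable_open/(finite_cubes_open Dc).
- apply: measurable_closed; apply: compact_closed cK.
  exact: (@norm_hausdorff R Rd).
- exact: measurable_on_subset mw.
- by move=> x /KO /w0.
Qed.

Lemma weight_cube_lty (w : Rd -> \bar R) (Q : set Rd) :
  weight Omega w -> cubes Q -> \int[mu]_(x in Q) w x < +oo.
Proof.
move=> ww cQ; rewrite -(bigcup_set1 id Q).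
by apply: weight_finite_cubes_lty => // _ ->.
Qed.

Lemma weight_ae_fin_num (w : Rd -> \bar R) (Q : set Rd) :
  weight Omega w -> cubes Q ->
  {ae leb, forall x, Q x -> w x \is a fin_num}.
Proof.
move=> ww cQ; have [mw w0 _] := ww.
apply: (@integrable_ae _ (Leb R n) _ mu Q (cubeM cQ)).
apply/integrableP; split; first by apply: measurable_on_subset mw; exact: cubeO.
rewrite (@eq_integral _ (Leb R n) R mu Q w); first exact: weight_cube_lty.
by move=> x; rewrite inE => Qx; rewrite gee0_abs// w0//; exact: cubeO cQ _ Qx.
Qed.

(** If the integral were 0, [sigma] would vanish and [v] be +oo almost everywhere on a cube of
    positive measure, against the local integrability of [v]. *)
Lemma dual_weight_cube_gt0 (p : R) (v : Rd -> \bar R) (Q : set Rd) :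
  weight Omega v -> weight Omega (dual_weight p v) -> cubes Q ->
  0 < \int[mu]_(x in Q) dual_weight p v x.
Proof.
move=> wv [ms s0 _] cQ; have [_ v0 _] := wv.
have mQ := cubeM cQ.
rewrite lt_neqAle integral_ge0 ?andbT; last first.
  by move=> x Qx; apply: s0; exact: cubeO cQ _ Qx.
apply/eqP => /esym I0; have := cubes_measure_gt0 cQ.
suff -> : mu Q = 0 by rewrite ltxx.
have aes : ae_eq leb Q (dual_weight p v) (cst 0).
  apply/(ae_eq_integral_abs _ mQ).
    by apply: measurable_on_subset ms; exact: cubeO.
  rewrite -[RHS]I0; apply: eq_integral => x; rewrite inE => Qx.
  by rewrite gee0_abs// s0//; exact: cubeO cQ _ Qx.
have aev := weight_ae_fin_num wv cQ.
apply: (@measure_negligible _ (Leb R n) _ mu) => //.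
have [N [mN N0 QN]] : {ae leb, forall x, ~ Q x}.
  apply: filterS2 aes aev => x /= sx vx Qx.
  have := @dual_weight_gt0 R n p v x (v0 _ (cubeO cQ Qx)) (vx Qx).
  by rewrite sx// ltxx.
by exists N; split=> // x Qx; apply: QN => /(_ Qx).
Qed.

(** [quotientK] gives the equality of the integrands wherever [v] and [sigma] are finite, which is
    almost everywhere on the cube. *)
Lemma integral_cube_quotient (p : R) (v f : Rd -> \bar R) (Q : set Rd) :
  (1 < p)%R -> weight Omega v -> weight Omega (dual_weight p v) -> cubes Q ->
  measurable_on Omega f ->
  \int[mu]_(x in Q) `|f x| =
  \int[mu]_(x in Q) (`| `|f x| * v x `^ (conj_exp p - 1) | * dual_weight p v x).
Proof.
move=> p1 wv ws cQ mf; have [mv v0 _] := wv; have [ms s0 _] := ws.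
have mfQ : measurable_on Q (fun x => `|f x|).
  apply: measurableT_comp; first exact: abse_measurable.
  by apply: measurable_on_subset mf; exact: cubeO.
have QO := cubeO cQ.
apply: (@ge0_ae_eq_integral _ (Leb R n)); first exact: cubeM.
- exact: mfQ.
- apply: emeasurable_funM; last exact: measurable_on_subset ms.
  apply: measurableT_comp; first exact: abse_measurable.
  apply: emeasurable_funM; first exact: mfQ.
  apply: (measurableT_comp (measurable_poweR _)).
  exact: measurable_on_subset mv.
- by [].
- by move=> x Qx; rewrite mule_ge0// s0//; exact: QO.
apply: filterS2 (weight_ae_fin_num wv cQ) (weight_ae_fin_num ws cQ).
  exact: (ae_filter_ringOfSetsType leb).
move=> x vx sx Qx.
rewrite [X in X * dual_weight _ _ _]gee0_abs ?mule_ge0 ?poweR_ge0//.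
by rewrite quotientK// ?v0//; [exact: QO|exact: vx|exact: sx].
Qed.

End weights.

(** * Measurability and nonnegativity of the maximal functions *)

Section characterization.
Context (R : realType) (n : nat) (Omega : set 'rV[R]_n.+1) (p beta : R).
Context (u v : 'rV[R]_n.+1 -> \bar R).
Local Notation Rd := 'rV[R]_n.+1.
Local Notation mu := (@lebesgue_rV R n).
Local Notation cubes := (cubes Omega beta).
Local Notation sigma := (dual_weight p v).
Local Notation M := (maxfun Omega beta).
Local Notation Ms := (wmaxfun Omega beta sigma).
Hypotheses (oO : open Omega) (ON : Omega !=set0) (OT : Omega <> setT).
Hypotheses (p1 : 1 < p) (b0 : 0 < beta) (b1 : beta < 1).
Hypotheses (wu : weight Omega u) (wv : weight Omega v).
Hypothesis ws : weight Omega sigma.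
Local Open Scope ereal_scope.

Let p0 : (0 < p)%R. Proof. exact: lt_trans p1. Qed.
Let mu_ : measurable_on Omega u. Proof. by case: wu. Qed.
Let mv : measurable_on Omega v. Proof. by case: wv. Qed.
Let ms : measurable_on Omega sigma. Proof. by case: ws. Qed.
Let u0 x : Omega x -> 0 <= u x. Proof. by case: wu => _ /(_ x). Qed.
Let v0 x : Omega x -> 0 <= v x. Proof. by case: wv => _ /(_ x). Qed.
Let s0 x : Omega x -> 0 <= sigma x. Proof. by case: ws => _ /(_ x). Qed.
Let mO : measurable (Omega : set (Leb R n)). Proof. exact: measurable_open. Qed.

Let cubeO (Q : set Rd) (cQ : cubes Q) := @cube_subset R n Omega beta OT b1 Q cQ.
Let cubeM (Q : set Rd) (cQ : cubes Q) := @cube_measurable R n Omega beta Q cQ.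
Let unionO (D : set (set Rd)) : D `<=` cubes -> \bigcup_(Q in D) Q `<=` Omega.
Proof. by move=> Dc x [Q /Dc/cubeO QO Qx]; exact: QO. Qed.
Let unionM (D : set (set Rd)) :
  D `<=` cubes -> measurable (\bigcup_(Q in D) Q : set (Leb R n)).
Proof. by move=> Dc; exact/measurable_open/(finite_cubes_open Dc). Qed.

Lemma measurable_on_restrict (A : set Rd) (f : Rd -> \bar R) :
  measurable (A : set (Leb R n)) -> A `<=` Omega ->
  measurable_on Omega f -> measurable_on Omega (f \_ A).
Proof.
move=> mA AO mf; apply/(@measurable_restrict _ _ (Leb R n)) => //.
by rewrite setIidr//; exact: measurable_on_subset mf.
Qed.

Lemma measurable_maxfun (f : Rd -> \bar R) : measurable_on Omega (M f).
Proof. exact: measurable_sup_cubes. Qed.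

Lemma measurable_wmaxfun (f : Rd -> \bar R) : measurable_on Omega (Ms f).
Proof. exact: measurable_sup_cubes. Qed.

Lemma maxfun_ge0 (f : Rd -> \bar R) x : Omega x -> 0 <= M f x.
Proof.
move=> Ox; apply: (sup_cubes_ge0 oO OT b0) => // Q.
by rewrite mule_ge0 ?inve_ge0// integral_ge0.
Qed.

Lemma wmaxfun_ge0 (f : Rd -> \bar R) x : Omega x -> 0 <= Ms f x.
Proof.
move=> Ox; have [Q cQ Qx] := cubes_cover oO OT b0 Ox.
apply: (@le_trans _ _ ((\int[mu]_(y in Q) sigma y)^-1 *
   \int[mu]_(y in Q) (`|f y| * sigma y))); last first.
  by apply: ereal_sup_ubound; exists Q.
by rewrite mule_ge0 ?inve_ge0// integral_ge0// => y Qy;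
   rewrite ?mule_ge0// s0//; exact: cubeO Qy.
Qed.

(** * Necessity of the testing condition *)

Definition testing_condition (C : R) : Prop :=
  forall D : set (set Rd), finite_set D -> D `<=` cubes ->
    let F := \bigcup_(Q in D) Q in
    \int[mu]_(x in F) (M (sigma \_ F) x `^ p * u x) <=
      C%:E * \int[mu]_(x in F) sigma x /\
    \int[mu]_(x in F) sigma x < +oo.

(** As sigma^p v <= sigma, the p-th power of the L^p(v) norm of sigma 1_F is at most sigma(F), which
    is finite because F lies in a compact subset of [Omega]. *)
Lemma testing_of_bounded : bounded_op Omega M p v p u ->
  exists C, testing_condition C.
Proof.
move=> [C HC]; exists (`|C| `^ p)%R => D fD Dc F.
have FO : F `<=` Omega := unionO Dc.
have mF : measurable (F : set (Leb R n)) := unionM Dc.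
have Fy : \int[mu]_(x in F) sigma x < +oo.
  exact: (weight_finite_cubes_lty oO OT b1).
split=> //; set f := sigma \_ F.
have mf : measurable_on Omega f.
  exact: measurable_on_restrict.
have fp0 x : Omega x -> 0 <= `|f x| `^ p * v x.
  by move=> Ox; rewrite mule_ge0 ?poweR_ge0// v0.
have mfp : measurable_on Omega (fun x => `|f x| `^ p * v x).
  by apply: measurable_on_poweR => //; exact: measurableT_comp.
have fs : \int[mu]_(x in Omega) (`|f x| `^ p * v x) <=
    \int[mu]_(x in F) sigma x.
  rewrite -(setIidr FO) integral_mkcondr.
  apply: ge0_le_integral => // x Ox; rewrite /f patchE; case: ifPn => // _.
    rewrite gee0_abs ?s0//; apply: dual_weight_poweR_le => //; exact: v0.
  by rewrite abse0 poweR0r ?gt_eqF// mul0e.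
have fLp : in_Lp Omega p v f by split=> //; exact: le_lt_trans Fy.
have mMp : measurable_on Omega (fun x => M f x `^ p * u x).
  by apply: measurable_on_poweR => //; exact: measurable_maxfun.
have Mp0 x : Omega x -> 0 <= M f x `^ p * u x.
  by move=> Ox; rewrite mule_ge0 ?poweR_ge0// u0.
apply: (@le_trans _ _ (\int[mu]_(x in Omega) (M f x `^ p * u x))).
  exact: ge0_subset_integral.
have -> : \int[mu]_(x in Omega) (M f x `^ p * u x) =
    \int[mu]_(x in Omega) (`|M f x| `^ p * u x).
  by apply: eq_integral => x; rewrite inE => Ox; rewrite gee0_abs// maxfun_ge0.
apply: (@le_trans _ _ ((`|C| `^ p)%:E *
    \int[mu]_(x in Omega) (`|f x| `^ p * v x))).
  apply: le_of_le_root => //; [|exact: integral_ge0|exact: HC].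
  by apply: integral_ge0 => x Ox; rewrite mule_ge0 ?poweR_ge0// u0.
by rewrite lee_wpmul2l// lee_fin powR_ge0.
Qed.


(** * Layer decomposition for finitely many cubes *)

Section sorted_family.
Variables (C : R) (N : nat) (Q : nat -> set Rd) (a : nat -> R).
Variables (f g : Rd -> \bar R).
Hypothesis testing : testing_condition C.
Hypothesis cQ : forall k, cubes (Q k).
Hypothesis a0 : forall k, (0 <= a k)%R.
Hypothesis a_decr : forall i j, (i <= j < N)%N -> (a j <= a i)%R.
Hypothesis aE : forall k, (\int[mu]_(y in Q k) sigma y)^-1 *
  \int[mu]_(y in Q k) (`|g y| * sigma y) = (a k)%:E.
Hypothesis fg : forall k, \int[mu]_(y in Q k) `|f y| =
  \int[mu]_(y in Q k) (`|g y| * sigma y).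

(** Indices start at 0, so [F m] consists of the first m + 1 cubes; the union over an image has the
    shape that [testing_condition] expects. *)
Let F (m : nat) : set Rd := \bigcup_(S in Q @` `I_m.+1) S.
(** The cutoff at [N] makes the last difference the whole power of the last average. *)
Let b (k : nat) : R := if (k < N)%N then (a k `^ p)%R else 0%R.
Let d (k : nat) : R := (b k - b k.+1)%R.

Let Qcubes m : Q @` `I_m.+1 `<=` cubes.
Proof. by move=> _ [k _ <-]. Qed.

Let FO m : F m `<=` Omega. Proof. exact: unionO. Qed.
Let mF m : measurable (F m : set (Leb R n)). Proof. exact: unionM. Qed.

Let d_ge0 k : (0 <= d k)%R.
Proof.
rewrite /d /b subr_ge0; case: ifPn => kN1; last first.
  by case: ifPn => // _; exact: powR_ge0.
by rewrite (ltnW kN1) ge0_ler_powR ?nnegrE ?(ltW p0)// a_decr// leqnSn.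
Qed.

Let sum_d i : (i < N)%N -> (\sum_(i <= m < N) d m = a i `^ p)%R.
Proof.
move=> iN; rewrite (telescope_sumr_eq (fun k => - b k)%R) ?(ltnW iN)//.
  by rewrite /b iN ltnn opprK oppr0 add0r.
by move=> k _; rewrite /d opprK addrC.
Qed.

(** Layer m is cut off to [F m], the set on which the testing condition integrates. *)
Let S_ (x : Rd) : \bar R := \sum_(0 <= m < N)
  (d m)%:E * ((fun y => M (sigma \_ (F m)) y `^ p * u y) \_ (F m)) x.

(** The layer-cake form of (max a_i 1_(Q_i))^p sigma. *)
Let T_ (x : Rd) : \bar R := \sum_(0 <= m < N) (d m)%:E * (sigma \_ (F m)) x.

Let Sterm_ge0 m x : Omega x ->
  0 <= (d m)%:E * ((fun y => M (sigma \_ (F m)) y `^ p * u y) \_ (F m)) x.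
Proof.
move=> Ox; rewrite mule_ge0 ?lee_fin ?d_ge0//.
by rewrite patchE; case: ifPn => // _; rewrite mule_ge0 ?poweR_ge0// u0.
Qed.

Let mS m : measurable_on Omega
  ((fun y => M (sigma \_ (F m)) y `^ p * u y) \_ (F m)).
Proof.
apply: measurable_on_restrict => //; apply: measurable_on_poweR => //.
exact: measurable_maxfun.
Qed.

Lemma average_poweR_le_layers i x : (i < N)%N -> Q i x ->
  ((mu (Q i))^-1 * \int[mu]_(y in Q i) `|f y|) `^ p * u x <= S_ x.
Proof.
move=> iN Qx; have Ox : Omega x := cubeO (cQ i) Qx.
have sQ0 := dual_weight_cube_gt0 oO OT b1 wv ws (cQ i).
have sQy := weight_cube_lty oO OT b1 ws (cQ i).
set sQ := \int[mu]_(y in Q i) sigma y in sQ0 sQy.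
(* Multiplying the average back by sigma(Q_i) is legitimate since this number is positive and
   finite. *)
have fE : \int[mu]_(y in Q i) `|f y| = sQ * (a i)%:E.
  rewrite fg -aE muleA divee ?mul1e ?gt_eqF//.
  by rewrite ge0_fin_numE// ltW.
have mQ0 : 0 <= (mu (Q i))^-1 by rewrite inve_ge0.
rewrite fE muleA poweRM ?lee_fin ?a0// ?mule_ge0 ?(ltW sQ0)//.
rewrite poweR_EFin -sum_d// -muleA -sumEFin.
have in_F m : (i <= m)%N -> Q i `<=` F m.
  by move=> im y Qy; exists (Q i) => //; exists i.
rewrite ge0_sume_distrl; last by move=> m _; rewrite lee_fin d_ge0.
rewrite ge0_sume_distrr; last first.
  by move=> m _; rewrite mule_ge0 ?u0// lee_fin d_ge0.
(* The layers m < i are nonnegative and dropped; the others are compared term by term. *)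
rewrite /S_ [leRHS](big_cat_nat (n := i)) ?(ltnW iN)//=.
apply: le_trans (leeDr _ _); last by apply: sume_ge0 => m _; exact: Sterm_ge0.
rewrite big_nat_cond [leRHS]big_nat_cond.
apply: lee_sum => m /andP[/andP[im mN] _].
rewrite muleCA lee_wpmul2l ?lee_fin ?d_ge0//.
rewrite patchE mem_set; last exact: in_F Qx.
rewrite lee_wpmul2r ?u0//; apply: le_poweR; rewrite ?(ltW p0)//.
  by rewrite mule_ge0// (ltW sQ0).
(* As Q_i lies in F_m, its own average of sigma 1_(F_m) competes in the supremum. *)
have -> : sQ = \int[mu]_(y in Q i) `|(sigma \_ (F m)) y|.
  apply: eq_integral => y; rewrite inE => Qy.
  rewrite patchE mem_set; last exact: in_F Qy.
  by rewrite gee0_abs// s0//; exact: cubeO Qy.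
by apply: ereal_sup_ubound; exists (Q i).
Qed.

(** For the first i with x in Q_i, the layers before i vanish at x and the others telescope to
    a_i^p, where a_i is one of the averages in the supremum. *)
Lemma layers_le_wmaxfun x : Omega x -> T_ x <= Ms g x `^ p * sigma x.
Proof.
move=> Ox.
have T0 : 0 <= Ms g x `^ p * sigma x by rewrite mule_ge0 ?poweR_ge0// s0.
have [iP|H] := pselect (exists i, (i < N)%N && `[<Q i x>]); last first.
  rewrite /T_ big_nat_cond big1// => m /andP[/andP[_ mN] _].
  rewrite patchE memNset ?mule0// => -[_ [j /= jm <-] Qjx]; apply: H; exists j.
  by rewrite (leq_trans _ mN)//; exact/asboolP.
case: (ex_minnP iP) => i /andP[iN /asboolP Qx] imin.
rewrite /T_ (big_cat_nat (n := i)) ?(ltnW iN)//=.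
rewrite big_nat_cond big1 ?add0e; last first.
  move=> m /andP[/andP[_ mi] _]; rewrite patchE memNset ?mule0//.
  move=> -[_ [j /= jm <-] Qjx]; have := imin j.
  rewrite (asboolT Qjx) (leq_trans jm (ltnW (leq_ltn_trans mi iN))) => /(_ isT).
  by rewrite leqNgt (leq_trans jm mi).
under eq_big_nat => m /andP[im mN].
  rewrite patchE mem_set; last by exists (Q i) => //; exists i.
  over.
rewrite -ge0_sume_distrl; last by move=> m _; rewrite lee_fin d_ge0.
rewrite sumEFin sum_d// -poweR_EFin lee_wpmul2r ?s0//.
apply: le_poweR; rewrite ?lee_fin ?(ltW p0)// -aE.
by apply: ereal_sup_ubound; exists (Q i).
Qed.

Lemma integral_layers_le : \int[mu]_(x in Omega) S_ x <=
  `|C|%:E * \int[mu]_(x in Omega) (Ms g x `^ p * sigma x).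
Proof.
have mT m : measurable_on Omega (sigma \_ (F m)).
  exact: measurable_on_restrict.
have s_ge0 m x : Omega x -> 0 <= (sigma \_ (F m)) x.
  by move=> Ox; rewrite patchE; case: ifPn => // _; exact: s0.
apply: (@le_trans _ _ (`|C|%:E * \int[mu]_(x in Omega) T_ x)); last first.
  apply: lee_wpmul2l; first by rewrite lee_fin.
  apply: ge0_le_integral; first exact: mO.
  - move=> x Ox; apply: sume_ge0 => m _.
    by rewrite mule_ge0 ?lee_fin ?d_ge0 ?s_ge0.
  - apply: emeasurable_sum => m.
    by apply: emeasurable_funM; [exact: measurable_cst|exact: mT].
  - by apply: measurable_on_poweR => //; exact: measurable_wmaxfun.
  - by move=> x Ox; exact: layers_le_wmaxfun.
rewrite (ge0_integral_sum mu mO); last 2 first.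
- move=> m; apply: emeasurable_funM; first exact: measurable_cst.
  exact: mS.
- by move=> m x Ox; exact: Sterm_ge0.
rewrite (ge0_integral_sum mu mO); last 2 first.
- move=> m; apply: emeasurable_funM; first exact: measurable_cst.
  exact: mT.
- by move=> m x Ox; rewrite mule_ge0 ?lee_fin ?d_ge0 ?s_ge0.
rewrite ge0_sume_distrr; last first.
  move=> m _; apply: integral_ge0 => x Ox.
  by rewrite mule_ge0 ?lee_fin ?d_ge0 ?s_ge0.
apply: lee_sum => m _.
rewrite (ge0_integralZl mu mO (mT m) (s_ge0 m)) ?lee_fin ?d_ge0//.
rewrite (ge0_integralZl mu mO (mS m)) ?lee_fin ?d_ge0//; last first.
  move=> x Ox; rewrite patchE; case: ifPn => // _.
  by rewrite mule_ge0 ?poweR_ge0// u0.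
rewrite muleCA lee_wpmul2l ?lee_fin ?d_ge0//.
rewrite -!integral_mkcondr setIidr; last exact: FO.
(* The testing condition for layer m, with C enlarged to its absolute value. *)
have [+ _] := testing (finite_image Q (finite_II m.+1)) (@Qcubes m).
move=> /le_trans; apply; rewrite lee_wpmul2r// ?lee_fin ?ler_norm//.
by apply: integral_ge0 => x Fx; rewrite s0//; exact: FO Fx.
Qed.

(** Hiding the layers leaves conclusions that do not refer to the order of the cubes. *)
Lemma sorted_family_majorant : exists S : Rd -> \bar R,
  [/\ measurable_on Omega S, forall x, Omega x -> 0 <= S x,
      forall i x, (i < N)%N -> Q i x ->
        ((mu (Q i))^-1 * \int[mu]_(y in Q i) `|f y|) `^ p * u x <= S x &
      \int[mu]_(x in Omega) S x <=
        `|C|%:E * \int[mu]_(x in Omega) (Ms g x `^ p * sigma x)].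
Proof.
exists S_; split.
- apply: emeasurable_sum => m.
  by apply: emeasurable_funM; [exact: measurable_cst|exact: mS].
- by move=> x Ox; apply: sume_ge0 => m _; exact: Sterm_ge0.
- exact: average_poweR_le_layers.
- exact: integral_layers_le.
Qed.

End sorted_family.

(** The indices below [N] are sorted by decreasing average, and each cube is found again through its
    position in the sorted list. *)
Lemma family_majorant (C : R) (N : nat) (Q : nat -> set Rd) (a : nat -> R)
    (f g : Rd -> \bar R) :
  testing_condition C ->
  (forall k, cubes (Q k)) -> (forall k, 0 <= a k)%R ->
  (forall k, (\int[mu]_(y in Q k) sigma y)^-1 *
    \int[mu]_(y in Q k) (`|g y| * sigma y) = (a k)%:E) ->
  (forall k, \int[mu]_(y in Q k) `|f y| =
    \int[mu]_(y in Q k) (`|g y| * sigma y)) ->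
  exists S : Rd -> \bar R,
  [/\ measurable_on Omega S, forall x, Omega x -> 0 <= S x,
      forall i x, (i < N)%N -> Q i x ->
        ((mu (Q i))^-1 * \int[mu]_(y in Q i) `|f y|) `^ p * u x <= S x &
      \int[mu]_(x in Omega) S x <=
        `|C|%:E * \int[mu]_(x in Omega) (Ms g x `^ p * sigma x)].
Proof.
move=> testing cQ a0 aE fg.
pose leT i j := (a j <= a i)%R.
have leT_total : total leT by move=> i j; exact: le_total.
have leT_trans : transitive leT by move=> j i k ji kj; exact: le_trans kj ji.
have leT_refl : reflexive leT by move=> i; exact: lexx.
pose s := sort leT (iota 0 N).
have ss : size s = N by rewrite size_sort size_iota.
have a_decr i j : (i <= j < N)%N -> (a (nth 0%N s j) <= a (nth 0%N s i))%R.
  move=> /andP[ij jN].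
  apply: (sorted_leq_nth leT_trans leT_refl) => //.
    exact: sort_sorted.
    by rewrite inE -/s ss (leq_ltn_trans ij).
  by rewrite inE -/s ss.
(* Beyond [N] the default of [nth] repeats index 0, so the hypotheses hold for every k. *)
have [S [mS S0 SQ IS]] := sorted_family_majorant testing
  (fun k => cQ (nth 0%N s k)) (fun k => a0 (nth 0%N s k)) a_decr
  (fun k => aE (nth 0%N s k)) (fun k => fg (nth 0%N s k)).
exists S; split => // i x iN Qix.
have is_ : i \in s by rewrite mem_sort mem_iota.
have := SQ (index i s) x; rewrite nth_index//; apply => //.
by rewrite -ss index_mem.
Qed.

(** * Sufficiency of the testing condition *)

(** An infinite average would make [Ms g] infinite on all of Q, where [sigma] has positive integral.
    Real averages are what the differences d_m require. *)
Lemma wmaxfun_average_fin_num (g : Rd -> \bar R) (Q : set Rd) :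
  measurable_on Omega g ->
  \int[mu]_(x in Omega) (Ms g x `^ p * sigma x) < +oo -> cubes Q ->
  (\int[mu]_(y in Q) sigma y)^-1 * \int[mu]_(y in Q) (`|g y| * sigma y)
    \is a fin_num.
Proof.
move=> mg Iy cQ; have QO := cubeO cQ; have mQ := cubeM cQ.
have sQ0 := dual_weight_cube_gt0 oO OT b1 wv ws cQ.
set A := _^-1 * _.
have A0 : 0 <= A.
  rewrite mule_ge0 ?inve_ge0 ?(ltW sQ0)//; apply: integral_ge0 => y Qy.
  by rewrite mule_ge0// s0//; exact: QO.
rewrite ge0_fin_numE// ltNge leye_eq; apply/negP => /eqP Ay.
move: Iy; apply/negP; rewrite -leNgt.
have mMs : measurable_on Omega (fun x => Ms g x `^ p * sigma x).
  by apply: measurable_on_poweR => //; exact: measurable_wmaxfun.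
have Ms0 x : Omega x -> 0 <= Ms g x `^ p * sigma x.
  by move=> Ox; rewrite mule_ge0 ?poweR_ge0// s0.
apply: (@le_trans _ _ (\int[mu]_(x in Q) (Ms g x `^ p * sigma x))); last first.
  exact: ge0_subset_integral.
have -> : \int[mu]_(x in Q) (Ms g x `^ p * sigma x) =
    \int[mu]_(x in Q) (+oo * sigma x).
  apply: eq_integral => x; rewrite inE => Qx; congr (_ * _).
  have -> : Ms g x = +oo.
    apply/eqP; rewrite -leye_eq -Ay; apply: ereal_sup_ubound.
    by exists Q.
  by rewrite poweRyr ?gt_eqF.
rewrite (ge0_integralZl mu mQ)//; first by rewrite gt0_mulye.
  exact: measurable_on_subset ms.
by move=> x Qx; rewrite s0//; exact: QO.
Qed.

Lemma bounded_of_testing : bounded_op Omega Ms p sigma p sigma ->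
  (exists C, testing_condition C) ->
  bounded_op Omega M p v p u.
Proof.
move=> [C2 H2] [C1 testing].
(* [C1] comes from testing and [C2], raised to the p-th power, from the bound on [Ms]; the root
   returns to norms. *)
exists (`| (`|C1| * `|C2| `^ p)%R | `^ p^-1)%R => f [mf fLp].
have If0 : 0 <= \int[mu]_(x in Omega) (`|f x| `^ p * v x).
  by apply: integral_ge0 => x Ox; rewrite mule_ge0 ?poweR_ge0// v0.
apply: root_le_of_le => //.
  by apply: integral_ge0 => x Ox; rewrite mule_ge0 ?poweR_ge0// u0.
have maf : measurable_on Omega (fun x => `|f x|) by exact: measurableT_comp.
(* This is |f| / sigma where 0 < v < +oo. *)
pose g x := `|f x| * v x `^ (conj_exp p - 1).
have mg : measurable_on Omega g.
  apply: emeasurable_funM; first exact: maf.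
  exact: (measurableT_comp (measurable_poweR _) mv).
have mag : measurable_on Omega (fun x => `|g x|) by exact: measurableT_comp.
have Ig : \int[mu]_(x in Omega) (`|g x| `^ p * sigma x) <=
    \int[mu]_(x in Omega) (`|f x| `^ p * v x).
  apply: ge0_le_integral; first exact: mO.
  - by move=> x Ox; rewrite mule_ge0 ?poweR_ge0// s0.
  - exact: measurable_on_poweR.
  - exact: measurable_on_poweR.
  - move=> x Ox; rewrite [X in X `^ _ * _ <= _]gee0_abs ?mule_ge0 ?poweR_ge0//.
    by apply: quotient_poweR_le => //; exact: v0.
have gLp : in_Lp Omega p sigma g by split=> //; exact: le_lt_trans fLp.
have IMs : \int[mu]_(x in Omega) (Ms g x `^ p * sigma x) <=
    (`|C2| `^ p)%:E * \int[mu]_(x in Omega) (`|f x| `^ p * v x).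
  apply: (@le_trans _ _ ((`|C2| `^ p)%:E *
      \int[mu]_(x in Omega) (`|g x| `^ p * sigma x))); last first.
    by rewrite lee_wpmul2l// lee_fin powR_ge0.
  rewrite (_ : \int[mu]_(x in Omega) _ =
      \int[mu]_(x in Omega) (`|Ms g x| `^ p * sigma x)); last first.
    apply: eq_integral => x; rewrite inE => Ox.
    by rewrite gee0_abs// wmaxfun_ge0.
  apply: le_of_le_root => //; last exact: H2.
  - by apply: integral_ge0 => x Ox; rewrite mule_ge0 ?poweR_ge0// s0.
  - by apply: integral_ge0 => x Ox; rewrite mule_ge0 ?poweR_ge0// s0.
have IMsy : \int[mu]_(x in Omega) (Ms g x `^ p * sigma x) < +oo.
  by apply: le_lt_trans IMs _; rewrite lte_mul_pinfty ?lee_fin ?powR_ge0.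
pose avg (Q : set Rd) := (mu Q)^-1 * \int[mu]_(y in Q) `|f y|.
have avg0 Q : 0 <= avg Q by rewrite mule_ge0 ?inve_ge0// integral_ge0.
have [q cq qP] := sup_cubes_countable oO OT b0 avg ON.
pose wavg Q := (\int[mu]_(y in Q) sigma y)^-1 *
  \int[mu]_(y in Q) (`|g y| * sigma y).
have wavg_fin k : wavg (q k) \is a fin_num.
  by apply: wmaxfun_average_fin_num => //; exact: cq.
have wavg0 k : (0 <= fine (wavg (q k)))%R.
  apply: fine_ge0; rewrite mule_ge0 ?inve_ge0//; apply: integral_ge0 => y Qy.
    by rewrite s0//; exact: cubeO (cq k) _ Qy.
  by rewrite mule_ge0// s0//; exact: cubeO (cq k) _ Qy.
have fg k : \int[mu]_(y in q k) `|f y| =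
    \int[mu]_(y in q k) (`|g y| * sigma y).
  by apply: (integral_cube_quotient oO OT b1) => //; exact: cq.
have majorant N := family_majorant N testing cq wavg0
  (fun k => esym (fineK (wavg_fin k))) fg.
(* The running maximum of the first [N] averages over cubes containing x, starting from 0. *)
pose run N x := iteri N (fun k => maxe (avg (q k) * (\1_(q k) x)%:E)) 0.
pose h N x := run N x `^ p * u x.
have avg_ind0 k x : 0 <= avg (q k) * (\1_(q k) x)%:E.
  by rewrite mule_ge0// lee_fin.
have run0 N x : 0 <= run N x.
  by elim: N => //= N IH; rewrite le_max IH orbT.
have mh N : measurable_on Omega (h N).
  apply: measurable_on_poweR => //; elim: N => [|N IH].
    exact: measurable_cst.
  apply: measurable_maxe; last exact: IH.
  apply: emeasurable_funM; first exact: measurable_cst.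
  by apply/measurable_EFinP/measurable_indic; exact: (cubeM (cq N)).
have h0 N x : Omega x -> 0 <= h N x.
  by move=> Ox; rewrite mule_ge0 ?poweR_ge0// u0.
have h_nd x : Omega x -> {homo h^~ x : N N' / (N <= N')%N >-> N <= N'}.
  move=> Ox; apply: homo_leq => [N|N K L|N]; [exact: lexx|exact: le_trans|].
  rewrite lee_wpmul2r ?u0//; apply: le_poweR => //; first exact: ltW.
  by rewrite /run /= le_max lexx orbT.
have h_le N : \int[mu]_(x in Omega) h N x <=
    (`|C1| * `|C2| `^ p)%:E * \int[mu]_(x in Omega) (`|f x| `^ p * v x).
  have [S [mS S0 SQ IS]] := majorant N.
  apply: (@le_trans _ _ (\int[mu]_(x in Omega) S x)).
    apply: ge0_le_integral; [exact: mO|exact: h0|exact: mh|exact: mS|].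
    move=> x Ox.
    (* The maximum is 0 or one of the averages, each of which [S] dominates; [N] stays fixed during
       the induction because [S] depends on it. *)
    suff run_le k : (k <= N)%N -> run k x `^ p * u x <= S x by exact: run_le.
    elim: k => [_|k IH kN]; first by rewrite poweR0r ?gt_eqF// mul0e S0.
    rewrite /run /= maxEle; case: ifPn => _; first exact: IH (ltnW kN).
    rewrite indicE; have [|_] := boolP (x \in q k).
      by rewrite inE mule1 => qx; exact: SQ.
    by rewrite mule0 poweR0r ?gt_eqF// mul0e S0.
  apply: le_trans IS _; rewrite EFinM -muleA; apply: lee_wpmul2l => //.
(* The limit of [h] dominates the integrand pointwise; monotone convergence then carries the uniform
   bound [h_le] to the limit. *)
apply: (@le_trans _ _ (\int[mu]_(x in Omega) (limn (h^~ x)))).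
  apply: ge0_le_integral; first exact: mO.
  - by move=> x Ox; rewrite mule_ge0 ?poweR_ge0// u0.
  - apply: measurable_on_poweR; last exact: mu_.
    by apply: measurableT_comp => //; exact: measurable_maxfun.
  - apply: (@emeasurable_fun_cvg _ (Leb R n) R Omega h
      (fun x => limn (h^~ x)) mh) => x Ox.
    by apply: ereal_nondecreasing_is_cvgn; exact: h_nd.
  - move=> x Ox; rewrite gee0_abs ?maxfun_ge0//.
    have hlim k : h k x <= limn (h^~ x).
      have := @ereal_nondecreasing_cvgn R (h^~ x) (h_nd x Ox).
      by move=> /cvg_lim -> //; apply: ereal_sup_ubound; exists k.
    apply: (@le_trans _ _
        (ereal_sup [set avg (q k) | k in [set k | q k x]] `^ p * u x)).
      rewrite lee_wpmul2r ?u0//; apply: le_poweR; first exact: ltW.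
        exact: maxfun_ge0.
      exact: qP.
    (* It suffices to treat single averages; the k-th one enters the running maximum at stage k +
       1. *)
    apply: ereal_sup_poweR_mul_le => //.
    + exact: u0.
    + by apply: le_trans (hlim 0%N); exact: h0.
    + by apply: le_trans (qP x); exact: maxfun_ge0.
    + by move=> _ [k _ <-].
    + move=> _ [k /= qx <-]; apply: le_trans (hlim k.+1).
      rewrite lee_wpmul2r ?u0//; apply: le_poweR; [exact: ltW|exact: avg0|].
      by rewrite /run /= indicE mem_set// mule1 le_max lexx.
rewrite (monotone_convergence mu mO mh h0 h_nd).
apply: lime_le; last by apply: nearW => N; exact: h_le.
apply: ereal_nondecreasing_is_cvgn => N N' NN'.
apply: ge0_le_integral; [exact: mO|exact: h0|exact: mh|exact: mh|].
by move=> x Ox; exact: h_nd.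
Qed.

End characterization.

Theorem theorem1p3 (R : realType) (n : nat) (Omega : set 'rV[R]_n.+1)
    (p beta : R) (u v : 'rV[R]_n.+1 -> \bar R) :
  open Omega -> Omega !=set0 -> Omega <> setT ->
  1 < p -> 0 < beta -> beta < 1 ->
  weight Omega u -> weight Omega v ->
  let sigma := dual_weight p v in
  weight Omega sigma ->
  bounded_op Omega (wmaxfun Omega beta sigma) p sigma p sigma ->
  bounded_op Omega (maxfun Omega beta) p v p u <->
  exists C : R, forall D : set (set 'rV[R]_n.+1),
    finite_set D -> D `<=` cubes Omega beta ->
    let F := \bigcup_(Q in D) Q in
    (\int[@lebesgue_rV R n]_(x in F)
        (maxfun Omega beta (sigma \_ F) x `^ p * u x) <=
      C%:E * \int[@lebesgue_rV R n]_(x in F) sigma x)%E /\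
    (\int[@lebesgue_rV R n]_(x in F) sigma x < +oo)%E.
Proof.
move=> oO ON OT p1 b0 b1 wu wv sigma ws Hs; split.
  exact: testing_of_bounded.
exact: bounded_of_testing.
Qed.
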